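(* Let $(D, \dashv, \vdash, \varepsilon, \alpha)$ be a Hom-left-symmetric color dialgebra whose two products $\dashv$ and $\vdash$ are both Hom-associative, i.e. $\alpha(x)\dashv(y\dashv z)=(x\dashv y)\dashv\alpha(z)$ and $\alpha(x)\vdash(y\vdash z)=(x\vdash y)\vdash\alpha(z)$ for all $x,y,z\in\mathcal{H}(D)$. Then $(D, \dashv, \vdash, \{-, -\}, \varepsilon, \alpha)$ is a Hom-Poisson color dialgebra, where $$\{x, y\}=x\dashv y-\varepsilon(x, y)\, y\vdash x$$ for all $x, y\in \mathcal{H}(D)$.
   Context: All vector spaces are over a field $\mathbb{K}$ of characteristic different from $2$, $G$ is an abelian group, and a linear map or bilinear map between $G$-graded spaces is called even if it preserves degree. $\mathcal{H}(A)$ denotes the set of homogeneous elements of a $G$-graded space $A$. A bicharacter on $G$ is a map $\varepsilon:G\times G\to\mathbb{K}^*$ with $\varepsilon(a,b)\varepsilon(b,a)=1$, $\varepsilon(a,b+c)=\varepsilon(a,b)\varepsilon(a,c)$, $\varepsilon(a+b,c)=\varepsilon(a,c)\varepsilon(b,c)$ for all $a,b,c\in G$. For homogeneous $x,y$ of degrees $a,b$ one writes $\varepsilon(x,y):=\varepsilon(a,b)$. A Hom-left-symmetric color dialgebra $(S,\dashv,\vdash,\varepsilon,\alpha)$ is a $G$-graded linear space $S$ with a bicharacter $\varepsilon$, an even linear map $\alpha:S\to S$ and two even bilinear products $\dashv,\vdash$ such that for all $x,y,z\in\mathcal{H}(S)$: $\alpha(x)\dashv(y\dashv z)=\alpha(x)\dashv(y\vdash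 z)$; $(x\vdash y)\vdash \alpha(z)=(x\dashv y)\vdash\alpha(z)$; $\alpha(x)\dashv(y\dashv z)-(x\dashv y)\dashv \alpha(z)=\varepsilon(x, y)\big(\alpha(y)\vdash(x\dashv z)-(y\vdash x)\dashv \alpha(z)\big)$; $\alpha(x)\vdash(y\vdash z)-(x\vdash y)\vdash \alpha(z)=\varepsilon(x, y)\big(\alpha(y)\vdash(x\vdash z)-(y\vdash x)\vdash \alpha(z)\big)$. A Hom-Poisson color dialgebra $(P,\dashv,\vdash,\{-,-\},\varepsilon,\alpha)$ is a $G$-graded linear space $P$ with three even bilinear maps $\dashv,\vdash,\{-,-\}$, a bicharacter $\varepsilon$ and an even linear map $\alpha:P\to P$ such that for all $x,y,z\in\mathcal{H}(P)$: $\{x\dashv y, \alpha(z)\}=\alpha(x)\dashv\{y, z\}+\varepsilon(y, z)\{x, z\}\dashv\alpha(y)$; $\{x\vdash y, \alpha(z)\}=\alpha(x)\vdash\{y, z\}+\varepsilon(y, z)\{x, z\}\vdash\alpha(y)$; $\{\alpha(x), y\dashv z\}=\varepsilon(x, y)\alpha(y)\vdash\{x, z\}+\{x, y\}\dashv\alpha(z)=\{\alpha(x), y\vdash z\}$. *)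

(* Defs.v *)
From HB Require Import structures.
From mathcomp Require Import all_boot all_order all_algebra.

Set Implicit Arguments.
Unset Strict Implicit.
Unset Printing Implicit Defensive.

Import GRing.Theory.
Local Open Scope ring_scope.

(* [A g] is the homogeneous component of degree [g] and [V] is the internal
   direct sum of these components; the index group may be infinite, so only
   finite families of degrees are summed. *)
Record is_grading (K : fieldType) (G : zmodType) (V : lmodType K)
    (A : G -> {pred V}) : Prop := IsGrading {
  grading_submod : forall g, submod_closed (A g);
  grading_span : forall v : V, exists (s : seq G) (f : G -> V),
    [/\ uniq s, (forall g, f g \in A g) & v = \sum_(g <- s) f g];
  grading_free : forall (s : seq G) (f : G -> V),
    uniq s -> (forall g, f g \in A g) -> \sum_(g <- s) f g = 0 ->
    forall g, g \in s -> f g = 0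
}.

Definition even_map (K : fieldType) (G : zmodType) (V : lmodType K)
    (A : G -> {pred V}) (f : V -> V) : Prop :=
  forall a x, x \in A a -> f x \in A a.

Definition even_product (K : fieldType) (G : zmodType) (V : lmodType K)
    (A : G -> {pred V}) (op : V -> V -> V) : Prop :=
  forall a b x y, x \in A a -> y \in A b -> op x y \in A (a + b).

Record is_bicharacter (K : fieldType) (G : zmodType)
    (eps : G -> G -> K) : Prop := IsBicharacter {
  bichar_neq0 : forall a b, eps a b != 0;
  bichar_skew : forall a b, eps a b * eps b a = 1;
  bichar_addr : forall a b c, eps a (b + c) = eps a b * eps a c;
  bichar_addl : forall a b c, eps (a + b) c = eps a c * eps b c
}.

(* In the identities below, "for all homogeneous x, y, z" is spelled
   "for all degrees a, b, c and all x, y, z in the components of these degrees",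
   and the sign eps(x, y) is [eps a b].  The zero vector lies in every
   component, but each identity is trivial as soon as one of its arguments
   is zero, so the choice of its degree is immaterial. *)

Definition hom_associative (K : fieldType) (G : zmodType) (V : lmodType K)
    (A : G -> {pred V}) (alpha : {linear V -> V})
    (op : {bilinear V -> V -> V}) : Prop :=
  forall a b c x y z, x \in A a -> y \in A b -> z \in A c ->
    op (alpha x) (op y z) = op (op x y) (alpha z).

Section ColorDialgebras.

Context (K : fieldType) (G : zmodType) (V : lmodType K) (A : G -> {pred V}).
Context (dl dr br : {bilinear V -> V -> V}).
Context (eps : G -> G -> K) (alpha : {linear V -> V}).

Local Notation "x ⊣ y" := (dl x y) (at level 40, left associativity).
Local Notation "x ⊢ y" := (dr x y) (at level 40, left associativity).
Local Notation "⦃ x , y ⦄" := (br x y).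

Record hom_left_symmetric_color_dialgebra : Prop :=
  HomLeftSymmetricColorDialgebra {
  hls_grading : is_grading A;
  hls_bicharacter : is_bicharacter eps;
  hls_even_alpha : even_map A alpha;
  hls_even_l : even_product A dl;
  hls_even_r : even_product A dr;
  hls_bar_l : forall a b c x y z, x \in A a -> y \in A b -> z \in A c ->
    alpha x ⊣ (y ⊣ z) = alpha x ⊣ (y ⊢ z);
  hls_bar_r : forall a b c x y z, x \in A a -> y \in A b -> z \in A c ->
    (x ⊢ y) ⊢ alpha z = (x ⊣ y) ⊢ alpha z;
  hls_sym_l : forall a b c x y z, x \in A a -> y \in A b -> z \in A c ->
    alpha x ⊣ (y ⊣ z) - (x ⊣ y) ⊣ alpha z
    = eps a b *: (alpha y ⊢ (x ⊣ z) - (y ⊢ x) ⊣ alpha z);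
  hls_sym_r : forall a b c x y z, x \in A a -> y \in A b -> z \in A c ->
    alpha x ⊢ (y ⊢ z) - (x ⊢ y) ⊢ alpha z
    = eps a b *: (alpha y ⊢ (x ⊢ z) - (y ⊢ x) ⊢ alpha z)
}.

Record hom_poisson_color_dialgebra : Prop := HomPoissonColorDialgebra {
  hp_grading : is_grading A;
  hp_bicharacter : is_bicharacter eps;
  hp_even_alpha : even_map A alpha;
  hp_even_l : even_product A dl;
  hp_even_r : even_product A dr;
  hp_even_br : even_product A br;
  hp_left_l : forall a b c x y z, x \in A a -> y \in A b -> z \in A c ->
    ⦃x ⊣ y, alpha z⦄
    = alpha x ⊣ ⦃y, z⦄ + eps b c *: (⦃x, z⦄ ⊣ alpha y);
  hp_left_r : forall a b c x y z, x \in A a -> y \in A b -> z \in A c ->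
    ⦃x ⊢ y, alpha z⦄
    = alpha x ⊢ ⦃y, z⦄ + eps b c *: (⦃x, z⦄ ⊢ alpha y);
  hp_right_l : forall a b c x y z, x \in A a -> y \in A b -> z \in A c ->
    ⦃alpha x, y ⊣ z⦄
    = eps a b *: (alpha y ⊢ ⦃x, z⦄) + ⦃x, y⦄ ⊣ alpha z;
  hp_right_r : forall a b c x y z, x \in A a -> y \in A b -> z \in A c ->
    eps a b *: (alpha y ⊢ ⦃x, z⦄) + ⦃x, y⦄ ⊣ alpha z
    = ⦃alpha x, y ⊢ z⦄
}.

Definition is_color_commutator : Prop :=
  forall a b x y, x \in A a -> y \in A b ->
    ⦃x, y⦄ = x ⊣ y - eps a b *: (y ⊢ x).

End ColorDialgebras.

(* Main.v *)
(* Hom-associativity of the left product makes the left-hand side of the third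
   dialgebra axiom vanish; since eps is invertible, this leaves the mixed law
   alpha y ⊢ (x ⊣ z) = (y ⊢ x) ⊣ alpha z.  Together with the bar identities it
   makes the Poisson identities hold term by term on homogeneous elements.  The
   formula for the bracket only makes sense on homogeneous elements, so it is
   first extended bilinearly through the projections onto the components. *)
Require Import Defs.
From HB Require Import structures.
From mathcomp Require Import all_boot all_order all_algebra.

Set Implicit Arguments.
Unset Strict Implicit.
Unset Printing Implicit Defensive.

Import GRing.Theory.
Local Open Scope ring_scope.

(** * Homogeneous components of a vector and linear maps defined degree by degree *)

Section HomogeneousComponents.

Context (K : fieldType) (G : zmodType) (V : lmodType K) (A : G -> {pred V}).
Context (hA : is_grading A).

Lemma homogeneous0 g : 0 \in A g.
Proof. by case: (grading_submod hA g). Qed.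

Lemma homogeneousP g k x y : x \in A g -> y \in A g -> k *: x + y \in A g.
Proof. by case: (grading_submod hA g) => _; apply. Qed.

Lemma homogeneousZ g k x : x \in A g -> k *: x \in A g.
Proof. by move=> Ax; rewrite -[_ *: _]addr0 homogeneousP ?homogeneous0. Qed.

Lemma homogeneousD g x y : x \in A g -> y \in A g -> x + y \in A g.
Proof. by move=> Ax; rewrite -[x]scale1r; apply: homogeneousP. Qed.

Lemma homogeneousB g x y : x \in A g -> y \in A g -> x - y \in A g.
Proof.
by move=> Ax Ay; rewrite -scaleN1r homogeneousD ?homogeneousZ.
Qed.

Lemma homogeneous_sum g I (r : seq I) (P : pred I) (f : I -> V) :
  (forall i, P i -> f i \in A g) -> \sum_(i <- r | P i) f i \in A g.
Proof.
move=> Af; elim/big_ind: _ => //; [exact: homogeneous0 | exact: homogeneousD].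
Qed.

Definition decomposition (v : V) (s : seq (G * V)) : bool :=
  all (fun p => p.2 \in A p.1) s && (v == \sum_(p <- s) p.2).

(* Stated for a sequence of pairs, which lives in a choiceType and satisfies a
   boolean predicate, so that [xchoose] needs no choice axiom. *)
Lemma decomposition_exists v : exists s, decomposition v s.
Proof.
have [s [f [_ Af ->]]] := grading_span hA v.
exists [seq (g, f g) | g <- s]; rewrite /decomposition big_map eqxx andbT.
by rewrite all_map; apply/allP => g _ /=.
Qed.

Definition hdecomp v := xchoose (decomposition_exists v).

Definition hsupp v : seq G := undup (unzip1 (hdecomp v)).

(** A decomposition may repeat a degree, hence the sum over all its pairs of degree [g]. *)
Definition hcomp (g : G) (v : V) : V := \sum_(p <- hdecomp v | p.1 == g) p.2.

Lemma hcomp_in g v : hcomp g v \in A g.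
Proof.
have /andP[/allP As _] := xchooseP (decomposition_exists v).
rewrite /hcomp big_seq_cond homogeneous_sum // => p /andP[sp /eqP <-].
exact: As.
Qed.

Lemma hcomp_supp g v : g \notin hsupp v -> hcomp g v = 0.
Proof.
rewrite mem_undup => gs; apply: big1_seq => p /andP[/eqP pg sp].
by rewrite -pg map_f in gs.
Qed.

Lemma hcomp_sum v : v = \sum_(g <- hsupp v) hcomp g v.
Proof.
have /andP[_ /eqP {1}->] := xchooseP (decomposition_exists v).
rewrite /hcomp (exchange_big_dep predT) //= [LHS]big_seq [RHS]big_seq.
apply: eq_bigr => p sp.
(* Each pair [p] is counted for the single degree [p.1], which occurs once in the support. *)
rewrite (eq_bigl (pred1 p.1)) => [|g]; last by rewrite /= eq_sym.
rewrite -big_filter filter_pred1_uniq ?undup_uniq ?mem_undup ?map_f //.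
by rewrite big_seq1.
Qed.

Lemma sum_over_supp (W : nmodType) (s t : seq G) (f : G -> W) :
    uniq s -> uniq t -> {subset s <= t} -> (forall g, g \notin s -> f g = 0) ->
  \sum_(g <- t) f g = \sum_(g <- s) f g.
Proof.
move=> Us Ut st f0; rewrite (bigID [in s]) /= [X in _ + X]big1 ?addr0 //.
rewrite -big_filter; apply: perm_big; apply: uniq_perm => //.
  exact: filter_uniq.
by move=> g; rewrite mem_filter andb_idr // => /st.
Qed.

(** The differences [hcomp h v - f h], summed over a list [t] containing both supports, give 0, so
    directness of the sum kills each of them. This frees [hcomp] from the arbitrary choice behind
    [hdecomp]. *)
Lemma hcomp_unique v s f :
    uniq s -> (forall g, f g \in A g) -> (forall g, g \notin s -> f g = 0) ->
    v = \sum_(g <- s) f g ->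
  forall g, hcomp g v = f g.
Proof.
move=> Us Af f0 vE g; pose t := undup (s ++ hsupp v).
have Ut : uniq t by apply: undup_uniq.
have st : {subset s <= t} by move=> h sh; rewrite mem_undup mem_cat sh.
have vt : {subset hsupp v <= t}.
  by move=> h vh; rewrite mem_undup mem_cat vh orbT.
have [tg|tg] := boolP (g \in t); last first.
  by rewrite f0 ?hcomp_supp //; apply: contra tg; [apply: vt | apply: st].
apply/eqP; rewrite -subr_eq0; apply/eqP.
apply: (grading_free hA (f := fun h => hcomp h v - f h)) tg => // [h|].
  by rewrite homogeneousB ?hcomp_in.
rewrite sumrB (sum_over_supp Us Ut st f0) -vE.
rewrite (sum_over_supp (undup_uniq _) Ut vt) => [|h /hcomp_supp //].
by rewrite -hcomp_sum subrr.
Qed.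

(** The chosen decompositions of [u], [v] and [k *: u + v] are unrelated; uniqueness of components
    is what links them. *)
Lemma hcomp_is_linear g : linear (hcomp g).
Proof.
move=> k u v; pose t := undup (hsupp u ++ hsupp v).
have sub_t w : {subset hsupp w <= t} ->
    w = \sum_(h <- t) hcomp h w.
  move=> wt; rewrite {1}[w]hcomp_sum; apply/esym/sum_over_supp => //.
  - exact: undup_uniq.
  - exact: undup_uniq.
  - exact: (fun h => @hcomp_supp h w).
apply: (@hcomp_unique _ t (fun h => k *: hcomp h u + hcomp h v)).
- exact: undup_uniq.
- by move=> h; rewrite homogeneousP ?hcomp_in.
- move=> h; rewrite mem_undup mem_cat negb_or => /andP[uh vh].
  by rewrite !hcomp_supp // scaler0 addr0.
rewrite big_split /= -scaler_sumr -!sub_t // => h wh;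
  by rewrite mem_undup mem_cat wh ?orbT.
Qed.

HB.instance Definition _ g :=
  GRing.isLinear.Build K V V *:%R (hcomp g) (hcomp_is_linear g).

Lemma hcomp_homogeneous a g x :
  x \in A a -> hcomp g x = if g == a then x else 0.
Proof.
move=> Ax; apply: (@hcomp_unique _ [:: a] (fun g => if g == a then x else 0)).
- by [].
- by move=> h; case: eqP => [->|_] //; apply: homogeneous0.
- by move=> h; rewrite inE => /negPf->.
- by rewrite big_seq1 eqxx.
Qed.

(* [gsum F] acts as [F g] on the component of degree [g]. *)
Definition gsum (W : lmodType K) (F : G -> V -> W) (v : V) : W :=
  \sum_(g <- hsupp v) F g (hcomp g v).

(** Linearity of each [F g] makes zero components harmless. Asking for vanishing components off [t],
    not for [hsupp v] inside [t], lets one list serve [u], [v] and [k *: u + v] at once. *)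
Lemma gsumE (W : lmodType K) (F : G -> {linear V -> W}) v t :
    uniq t -> (forall g, g \notin t -> hcomp g v = 0) ->
  gsum F v = \sum_(g <- t) F g (hcomp g v).
Proof.
move=> Ut v0; pose r := undup (t ++ hsupp v).
have Ur : uniq r by apply: undup_uniq.
transitivity (\sum_(g <- r) F g (hcomp g v)).
  apply/esym/sum_over_supp => //; first exact: undup_uniq.
    by move=> g vg; rewrite mem_undup mem_cat vg orbT.
  by move=> g /hcomp_supp->; rewrite linear0.
apply: sum_over_supp => // g; last by move/v0->; rewrite linear0.
by rewrite mem_undup mem_cat => ->.
Qed.

Lemma gsum_is_linear (W : lmodType K) (F : G -> {linear V -> W}) :
  linear (gsum F).
Proof.
move=> k u v; pose t := undup (hsupp u ++ hsupp v).
have t0 w : {subset hsupp w <= t} -> forall g, g \notin t -> hcomp g w = 0.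
  by move=> wt g tg; apply: hcomp_supp; apply: contra tg => /wt.
have u0 : forall g, g \notin t -> hcomp g u = 0.
  by apply: t0 => g ug; rewrite mem_undup mem_cat ug.
have v0 : forall g, g \notin t -> hcomp g v = 0.
  by apply: t0 => g vg; rewrite mem_undup mem_cat vg orbT.
have Ut : uniq t by apply: undup_uniq.
rewrite (gsumE F Ut u0) (gsumE F Ut v0) (gsumE F Ut); last first.
  by move=> g tg; rewrite linearP /= u0 // v0 // scaler0 addr0.
by rewrite scaler_sumr -big_split; apply: eq_bigr => g _; rewrite !linearP.
Qed.

HB.instance Definition _ (W : lmodType K) (F : G -> {linear V -> W}) :=
  GRing.isLinear.Build K V W *:%R (gsum F) (gsum_is_linear F).

Lemma gsum_homogeneous (W : lmodType K) (F : G -> {linear V -> W}) a x :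
  x \in A a -> gsum F x = F a x.
Proof.
move=> Ax; rewrite (@gsumE _ _ _ [:: a]) // => [|g].
  by rewrite big_seq1 (hcomp_homogeneous _ Ax) eqxx.
by rewrite inE (hcomp_homogeneous _ Ax) => /negPf->.
Qed.

(** Homogeneous elements span [V]; this yields uniqueness of the bracket. *)
Lemma bilinear_eq_homogeneous (W : lmodType K) (f h : {bilinear V -> V -> W}) :
    (forall a b x y, x \in A a -> y \in A b -> f x y = h x y) ->
  forall x y, f x y = h x y.
Proof.
move=> fh x y; rewrite [x]hcomp_sum [y]hcomp_sum !linear_sumlz.
apply: eq_bigr => a _; rewrite !linear_sumr; apply: eq_bigr => b _.
by apply: fh; apply: hcomp_in.
Qed.

End HomogeneousComponents.

(** * Bilinear extension of the color commutator *)

Section ColorCommutator.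

Context (K : fieldType) (G : zmodType) (V : lmodType K) (A : G -> {pred V}).
Context (dl dr : {bilinear V -> V -> V}) (eps : G -> G -> K).
Context (hA : is_grading A).

(** Multiplication by the sign of a degree [a] element against [y], applied to each component of
    [y], so that [y] need not be homogeneous. *)
Definition twist (a : G) : V -> V :=
  gsum hA (fun b => eps a b \*: idfun).

HB.instance Definition _ a := GRing.Linear.on (twist a).

Lemma twist_homogeneous a b y : y \in A b -> twist a y = eps a b *: y.
Proof. by move=> Ay; rewrite /twist (gsum_homogeneous _ _ Ay). Qed.

Definition color_commutator (x y : V) : V :=
  dl x y - gsum hA (fun a => dr (twist a y)) x.

Lemma color_commutator_is_bilinear : bilinear_for *:%R *:%R color_commutator.
Proof.
have lin_l y : linear (color_commutator^~ y).
  move=> k u v; rewrite /color_commutator linearPl linearP /=.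
  by rewrite scalerBr opprD addrACA.
have lin_r x : linear (color_commutator x).
  move=> k u v; rewrite /color_commutator linearPr.
  rewrite scalerBr addrACA -opprD; congr (_ - _).
  (* The range of summation depends on [x] only, so linearity in [y] is checked term by term. *)
  rewrite /gsum scaler_sumr -big_split; apply: eq_bigr => a _ /=.
  by rewrite linearP linearPl.
by split=> [y|x]; [exact: lin_l | exact: lin_r].
Qed.

HB.instance Definition _ :=
  bilinear_isBilinear.Build K V V V *:%R *:%R color_commutator
    color_commutator_is_bilinear.

Lemma color_commutatorP : is_color_commutator A dl dr color_commutator eps.
Proof.
move=> a b x y Ax Ay; rewrite /= /color_commutator (gsum_homogeneous _ _ Ax).
by rewrite (twist_homogeneous _ Ay) /= linearZl_LR.
Qed.

End ColorCommutator.

(** * The Hom-Poisson identities for the color commutator *)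

Section Poisson.

Context (K : fieldType) (G : zmodType) (D : lmodType K) (A : G -> {pred D}).
Context (dl dr br : {bilinear D -> D -> D}) (eps : G -> G -> K).
Context (alpha : {linear D -> D}).
Context (hD : hom_left_symmetric_color_dialgebra A dl dr eps alpha).
Context (assoc_l : hom_associative A alpha dl).
Context (assoc_r : hom_associative A alpha dr).
Context (brE : is_color_commutator A dl dr br eps).

Lemma inner_hom_associative a b c x y z :
    x \in A a -> y \in A b -> z \in A c ->
  dr (alpha x) (dl y z) = dl (dr x y) (alpha z).
Proof.
(* The axiom is taken with [x] and [y] exchanged, so that [alpha x] lands on the surviving side. *)
move=> Ax Ay Az; have := hls_sym_l hD Ay Ax Az.
rewrite (assoc_l Ay Ax Az) subrr => /esym/eqP.
rewrite scaler_eq0 (negPf (bichar_neq0 (hls_bicharacter hD) b a)) /=.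
by rewrite subr_eq0 => /eqP.
Qed.

Lemma color_commutator_hom_poisson :
  hom_poisson_color_dialgebra A dl dr br eps alpha.
Proof.
have hA := hls_grading hD; have he := hls_bicharacter hD.
have Aal := hls_even_alpha hD; have Al := hls_even_l hD.
have Ar := hls_even_r hD.
have Abr : even_product A br.
  move=> a b x y Ax Ay; rewrite (brE Ax Ay) homogeneousB ?homogeneousZ ?Al //.
  by rewrite addrC Ar.
split=> // a b c x y z Ax Ay Az.
- rewrite (brE (Al _ _ _ _ Ax Ay) (Aal _ _ Az)) (brE Ay Az) (brE Ax Az).
  rewrite bichar_addl // !linearB /= !linearBl !linearZr_LR !linearZl_LR /=.
  rewrite !scalerBr.
  (* The term [(x ⊣ z) ⊣ alpha y] becomes [alpha x ⊣ (z ⊢ y)] and cancels; the mixed law matches the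
     terms starting with [z]. *)
  rewrite -(assoc_l Ax Ay Az) -(assoc_l Ax Az Ay) (hls_bar_l hD Ax Az Ay).
  rewrite (inner_hom_associative Az Ax Ay) scalerA addrA subrK.
  by rewrite [eps a c * _]mulrC.
- rewrite (brE (Ar _ _ _ _ Ax Ay) (Aal _ _ Az)) (brE Ay Az) (brE Ax Az).
  rewrite bichar_addl // !linearB /= !linearBl !linearZr_LR !linearZl_LR /=.
  rewrite !scalerBr.
  rewrite (inner_hom_associative Ax Ay Az) (assoc_r Az Ax Ay).
  (* Now [(x ⊣ z) ⊢ alpha y] becomes [alpha x ⊢ (z ⊢ y)] and cancels. *)
  rewrite -(hls_bar_r hD Ax Az Ay) -(assoc_r Ax Az Ay) scalerA addrA subrK.
  by rewrite [eps a c * _]mulrC.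
- rewrite (brE (Aal _ _ Ax) (Al _ _ _ _ Ay Az)) (brE Ax Az) (brE Ax Ay).
  rewrite bichar_addr // !linearB /= !linearBl !linearZr_LR !linearZl_LR /=.
  (* In both right identities the mixed law equates [alpha y ⊢ (x ⊣ z)] with [(y ⊢ x) ⊣ alpha z],
     and these cancel. *)
  rewrite (inner_hom_associative Ay Ax Az) (assoc_l Ax Ay Az).
  rewrite (assoc_r Ay Az Ax) (hls_bar_r hD Ay Az Ax) scalerA.
  by rewrite [RHS]addrC addrA subrK.
- rewrite (brE (Aal _ _ Ax) (Ar _ _ _ _ Ay Az)) (brE Ax Az) (brE Ax Ay).
  rewrite bichar_addr // !linearB /= !linearBl !linearZr_LR !linearZl_LR /=.
  rewrite (inner_hom_associative Ay Ax Az) -(assoc_l Ax Ay Az).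
  rewrite (assoc_r Ay Az Ax) -(hls_bar_l hD Ax Ay Az) scalerA.
  by rewrite [LHS]addrC addrA subrK.
Qed.

End Poisson.

Theorem theorem2p20 (K : fieldType) (charK : 2%N \notin [pchar K])
    (G : zmodType) (D : lmodType K) (A : G -> {pred D})
    (dl dr : {bilinear D -> D -> D}) (eps : G -> G -> K)
    (alpha : {linear D -> D})
    (hD : hom_left_symmetric_color_dialgebra A dl dr eps alpha)
    (assoc_l : hom_associative A alpha dl)
    (assoc_r : hom_associative A alpha dr) :
  exists br : {bilinear D -> D -> D},
    [/\ is_color_commutator A dl dr br eps,
        (forall br' : {bilinear D -> D -> D},
           is_color_commutator A dl dr br' eps ->
           forall x y, br' x y = br x y)
      & hom_poisson_color_dialgebra A dl dr br eps alpha].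
Proof.
have hA := hls_grading hD.
have brP := color_commutatorP dl dr eps hA.
exists (color_commutator dl dr eps hA); split=> [//|br' br'P|].
  apply: (bilinear_eq_homogeneous hA) => a b x y Ax Ay.
  by rewrite (br'P _ _ _ _ Ax Ay) (brP _ _ _ _ Ax Ay).
exact: color_commutator_hom_poisson.
Qed.
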